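(* Let $m_j>0$ be fixed. Consider the property that there are operators $T=T_\delta$, $\delta>0$, acting on $L^\infty(\mathbb{R})$ (linear or nonlinear, and allowed to depend on $\delta$ and $m_j$), and a function $\eta(\delta)$, such that $$\sup_{f\in\mathcal{K}(\delta,m_j)} \|T f_\delta-f'\|_\infty\le \eta(\delta)\to 0\quad\text{as }\delta\to 0,\qquad ( * )$$ where for each $\delta>0$ the supremum is taken over all pairs $(f,f_\delta)$ with $f_\delta\in L^\infty(\mathbb{R})$ and $f\in\mathcal{K}(\delta,m_j)$. (i) If $j=0$ or $j=1$, there does not exist an operator $T$ such that $( * )$ holds. (ii) If $j>1$, there exists an operator $T$ such that $( * )$ holds. For example, one can take $T=L_{\delta,j}$, where $$(L_{\delta,j}f_\delta)(x):=\frac{f_\delta(x+h_j(\delta))-f_\delta(x-h_j(\delta))}{2h_j(\delta)},\qquad h_j(\delta):=\left(\frac{\delta}{m_j(j-1)}\right)^{1/j},$$ and then $$\sup_{f\in\mathcal{K}(\delta,m_j)}\|L_{\delta,j}f_\delta-f'\|_\infty\le c_j\,\delta^{\frac{j-1}{j}},\quad 1<j\le 2,\qquad c_j:=\frac{j}{(j-1)^{\frac{j-1}{j}}}\,m_j^{1/j},$$ with the supremum over the same pairs $(f,f_\delta)$.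
   Context: $\|\cdot\|_\infty$ is the $L^\infty(\mathbb{R})$ norm. The problem is to estimate the derivative $f'$ of an unknown function $f$ on $\mathbb{R}$ from the data $\{\delta,f_\delta,m_j\}$, where $f_\delta\in L^\infty(\mathbb{R})$ is a noisy version of $f$. Given $f_\delta$, the class $\mathcal{K}(\delta,m_j)$ is the set of all functions $f\in C^j(\mathbb{R})$ with $\|f-f_\delta\|_\infty\le\delta$ and with the a priori bound $\|f^{(j)}\|\le m_j$. In detail: - for $j=0$: $f\in C^1(\mathbb{R})$ (so that $f'$ makes sense) and $\|f\|_\infty\le m_0$; - for $j=1$: $f\in C^1(\mathbb{R})$ and $\|f'\|_\infty\le m_1$; - for $j=1+a$ with $0<a\le 1$: $f\in C^1(\mathbb{R})$ (and $f\in C^2(\mathbb{R})$ if $j=2$) and $\|f^{(1+a)}\|\le m_{1+a}$, where $$\|f^{(1+a)}\|:=\|f'\|_\infty+\sup_{x,y\in\mathbb{R},\,x\ne y}\frac{|f'(x)-f'(y)|}{|x-y|^a};$$ - for integer $j>2$: $f\in C^j(\mathbb{R})$ and $\|f^{(j)}\|_\infty\le m_j$; for non-integer $j=k+a>2$ with $k\ge2$ an integer and $0<a<1$: $f\in C^k(\mathbb{R})$ and $\|f^{(k)}\|_\infty+\sup_{x\ne y}|f^{(k)}(x)-f^{(k)}(y)|/|x-y|^a\le m_j$.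
   Formalization: That one can take T = L_{δ,j} in ( * ) is stated only for 1 < j < 4, since for j ≥ 4 its worst-case error is infinite (f = f_δ = c w^{-k} sin(wx), k = ⌊j⌋, w → 0); existence of some T is kept for all j > 1 and the rate for 1 < j ≤ 2. *)

(* Defs.v *)
From HB Require Import structures.
From mathcomp Require Import all_boot all_order all_algebra.
From mathcomp Require Import all_classical all_reals all_analysis.
From mathcomp Require Import measurable_realfun ess_sup_inf.
Import Order.TTheory GRing.Theory Num.Theory numFieldNormedType.Exports.

Set Implicit Arguments.
Unset Strict Implicit.
Unset Printing Implicit Defensive.

Local Open Scope ring_scope.
Local Open Scope classical_set_scope.

(* The space L^oo(R): classes, modulo almost everywhere equality, of
   measurable essentially bounded functions.  A class is coerced to one of its
   representatives when it is used as a function. *)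
Notation Linfty R := (LspaceType (@lebesgue_measure R) (leey 1)).

(* f is not required to be essentially bounded: the value may be +oo. *)
Definition supnorm (R : realType) (f : R -> R) : \bar R :=
  'N[@lebesgue_measure R]_+oo[EFin \o f]%E.

Definition continuously_derivable (R : realType) (k : nat) (f : R -> R) :
    Prop :=
  (forall i x, (i < k)%N -> derivable f^`(i) x 1) /\ continuous f^`(k).

Definition holder_seminorm (R : realType) (a : R) (f : R -> R) : \bar R :=
  ereal_sup [set ((`|f z.1 - f z.2| / `|z.1 - z.2| `^ a)%:E)
            | z in [set z : R * R | z.1 != z.2]].

(* Number of continuous derivatives required of the members of the class of
   index j: one if j = 0 or 1 <= j < 2, and the integer part of j if 2 <= j. *)
Definition class_order (R : realType) (j : R) : nat := maxn 1 (Num.truncn j).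

(* Only j = 0 and 1 <= j are meaningful. *)
Definition apriori_norm (R : realType) (j : R) (f : R -> R) : \bar R :=
  let k := Num.truncn j in
  if j == 0 then supnorm f
  else if j == 1 then supnorm f^`()
  else if j <= 2 then (supnorm f^`() + holder_seminorm (j - 1) f^`())%E
  else if j == k%:R then supnorm f^`(k)
  else (supnorm f^`(k) + holder_seminorm (j - k%:R) f^`(k))%E.

Definition Kclass (R : realType) (j m delta : R) (g : Linfty R) :
    set (R -> R) :=
  [set f | [/\ continuously_derivable (class_order j) f,
               (supnorm (f \- g)%R <= delta%:E)%E &
               (apriori_norm j f <= m%:E)%E]].

Definition worst_case_error (R : realType) (j m delta : R)
    (T : Linfty R -> Linfty R) : \bar R :=
  ereal_sup [set supnorm (T fg.2 \- fg.1^`())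
            | fg in [set fg : (R -> R) * Linfty R |
                     Kclass j m delta fg.2 fg.1]].

Definition stable_estimator (R : realType) (j m : R)
    (T : R -> Linfty R -> Linfty R) : Prop :=
  exists eta : R -> R,
    (forall delta, 0 < delta ->
       (worst_case_error j m delta (T delta) <= (eta delta)%:E)%E) /\
    eta delta @[delta --> 0^'+] --> 0.

Definition diffquot (R : realType) (h : R) (f : R -> R) : R -> R :=
  fun x => (f (x + h) - f (x - h)) / (2 * h).

Lemma measurable_diffquot (R : realType) (h : R)
    (f : measurableTypeR R -> measurableTypeR R) :
  measurable_fun setT f ->
  measurable_fun setT
    (diffquot h f : measurableTypeR R -> measurableTypeR R).
Proof.
move=> mf; rewrite /diffquot; apply: measurable_funM => //.
by apply: measurable_funB; apply: (measurableT_comp mf);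
  [exact: measurable_funD|exact: measurable_funB].
Qed.

Lemma lebesgue_measure_shift (R : realType) (c : R) (A : set R) :
  measurable A ->
  lebesgue_measure ((fun x : R => x + c) @^-1` A) = lebesgue_measure A.
Proof.
move=> mA.
have mc : measurable_fun setT
    (fun x : measurableTypeR R => (x + c : measurableTypeR R)).
  exact: measurable_funD.
rewrite -[LHS]/(pushforward lebesgue_measure
  (fun x : R => (x + c : measurableTypeR R)) A).
apply/esym; pose phi : {mfun measurableTypeR R >-> measurableTypeR R} :=
  HB.pack (fun x : measurableTypeR R => (x + c : measurableTypeR R))
   (isMeasurableFun.Build _ _ _ _ _ mc).
apply: (@lebesgue_measure_unique R (pushforward lebesgue_measure phi)) => //.
move=> _ [[a b]] _ <-.
change (lebesgue_measure `]a, b]%classic =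
  lebesgue_measure ((fun x : R => x + c) @^-1` `]a, b]%classic)).
have -> : (fun x : R => x + c) @^-1` `]a, b]%classic = `]a - c, b - c]%classic.
  by apply/seteqP; split=> x /=; rewrite !in_itv/= ltrBlDr lerBrDr.
rewrite !lebesgue_measure_itv/= !lte_fin ltrD2r; case: ifP => // _.
by rewrite -!EFinB; congr (_%:E); rewrite opprB addrA subrK.
Qed.

Lemma ae_shift (R : realType) (c : R) (P : R -> Prop) :
  (\forall x \ae @lebesgue_measure R, P x) ->
  \forall x \ae @lebesgue_measure R, P (x + c).
Proof.
move=> [N [mN N0 PN]]; exists ((fun x : R => x + c) @^-1` N); split.
- rewrite -[X in measurable X]setTI; apply: (_ : measurable_fun setT
    (fun x : measurableTypeR R => (x + c : measurableTypeR R))) => //.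
  exact: measurable_funD.
- by rewrite -N0; exact: lebesgue_measure_shift.
- by move=> x /= nP; apply: PN.
Qed.

Lemma finite_norm_diffquot (R : realType) (h : R) (f : R -> R) :
  finite_norm (@lebesgue_measure R) +oo f ->
  finite_norm (@lebesgue_measure R) +oo (diffquot h f).
Proof.
rewrite /finite_norm unlock; case: ifPn => // _ foo.
have [M fM] : exists M : R, \forall x \ae @lebesgue_measure R, `|f x| <= M.
  suff [M /ess_supP fM] : exists M : R,
      (ess_sup lebesgue_measure (abse \o (EFin \o f)) <= M%:E)%E.
    by exists M; apply: filterS fM => x /=; rewrite lee_fin.
  case: (ess_sup _ _) foo => [r _|//|_]; first by exists r.
  by exists 0; exact: leNye.
apply: (@le_lt_trans _ _ ((M + M) * `|(2 * h)^-1|)%:E); last exact: ltry.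
apply/ess_supP.
have aeF := ae_filter_ringOfSetsType (@lebesgue_measure R).
apply: (@filterS2 _ _ aeF _ _ _ _ (ae_shift h fM) (ae_shift (- h) fM)).
move=> x fMp fMm /=.
rewrite lee_fin /diffquot normrM ler_wpM2r//.
by rewrite (le_trans (ler_normB _ _))// lerD.
Qed.

Section diffquot_op.
Context (R : realType) (h : R) (g : Linfty R).

Let measurable_q : measurable_fun setT
  (diffquot h (g : R -> R) : measurableTypeR R -> measurableTypeR R).
Proof.
apply: measurable_diffquot.
exact: (measurable_funPT (repr (LebesgueSpace.sort g))).
Qed.

Definition diffquot_mfun : {mfun measurableTypeR R >-> measurableTypeR R} :=
  HB.pack (diffquot h (g : R -> R) : measurableTypeR R -> measurableTypeR R)
    (isMeasurableFun.Build _ _ _ _ _ measurable_q).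

Definition diffquot_class :
    aeEqMfun (measurableTypeR R) (@lebesgue_measure R) :=
  (\pi_(aeEqMfun (measurableTypeR R) (@lebesgue_measure R)) diffquot_mfun)%qT.

Lemma diffquot_classE : (diffquot_class : R -> R) = diffquot h (g : R -> R)
  %[ae @lebesgue_measure R].
Proof.
have /eqP/eqmodP/asboolP : (\pi_(aeEqMfun (measurableTypeR R)
    (@lebesgue_measure R)) (repr diffquot_class) == \pi diffquot_mfun)%qT.
  by rewrite reprK.
exact.
Qed.

Let finite_norm_diffquot_class :
  finite_norm (@lebesgue_measure R) +oo (diffquot_class : R -> R).
Proof.
have := finite_norm_diffquot h (Lebesgue_finite (s := g)).
rewrite /finite_norm unlock; case: ifPn => // _.
rewrite (@eq_ess_sup _ _ _ _ _ (abse \o (EFin \o diffquot_class)))//.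
have aeF := ae_filter_ringOfSetsType (@lebesgue_measure R).
by apply: (@filterS _ _ aeF _ _ _ diffquot_classE) => x /(_ I) /= ->.
Qed.

Definition diffquot_op : Linfty R :=
  HB.pack diffquot_class
    (isFinLebesgue.Build _ _ _ _ _ (leey 1) _ finite_norm_diffquot_class).

End diffquot_op.

(* diffquot_op h g does not depend on the representative chosen for g. *)
Lemma diffquot_opE (R : realType) (h : R) (g : Linfty R) (f : R -> R) :
  (g : R -> R) = f %[ae @lebesgue_measure R] ->
  (diffquot_op h g : R -> R) = diffquot h f %[ae @lebesgue_measure R].
Proof.
move=> gf; have aeF := ae_filter_ringOfSetsType (@lebesgue_measure R).
apply: (@filterS3 _ _ aeF _ _ _ _ _ (diffquot_classE h g)
  (ae_shift h gf) (ae_shift (- h) gf)).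
by move=> x /(_ I) gE /(_ I) fp /(_ I) fm _; rewrite /= gE /diffquot fp fm.
Qed.

Definition diffquot_step (R : realType) (j m delta : R) : R :=
  (delta / (m * (j - 1))) `^ j^-1.

Definition L_op (R : realType) (j m delta : R) : Linfty R -> Linfty R :=
  diffquot_op (diffquot_step j m delta).

Definition rate_constant (R : realType) (j m : R) : R :=
  j / (j - 1) `^ ((j - 1) / j) * m `^ j^-1.

(* Main.v *)
(* For j = 0 or 1, [delta * sin (m / delta * x)] and its opposite are both
   compatible with the data 0, while their derivatives at 0 are m and - m.

   For 1 < j < 4, the noise contributes at most delta / h to the error of the
   central difference quotient, and a smooth member of the class differs from
   its own quotient by at most m h^p, where p = j - 1, 1 or 2 according to
   whether j <= 2, 2 < j < 3 or 3 <= j < 4.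

   For every j > 2, any choice of a compatible member of the class gives a
   stable estimator: two compatible members differ by at most 2 delta, their
   difference has a derivative of order [truncn j] >= 2 bounded by 2 m, and an
   inequality of Landau-Kolmogorov type makes its first derivative small. *)
From HB Require Import structures.
Require Import Defs.
From mathcomp Require Import all_boot all_order all_algebra.
From mathcomp Require Import all_classical all_reals all_analysis.
From mathcomp Require Import measurable_realfun ess_sup_inf ring lra.
Import Order.TTheory GRing.Theory Num.Theory numFieldNormedType.Exports.

Local Open Scope ring_scope.
Local Open Scope classical_set_scope.

(** * Essential bounds, continuous functions and elements of [Linfty R] *)

(** By continuity, a violation at one point persists on an interval, which has positive measure and
    so cannot lie in a null set. *)
Lemma ae_le_everywhere {R : realType} (f : R -> R) (M : R) :
  continuous f -> (\forall x \ae @lebesgue_measure R, f x <= M) ->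
  forall x, f x <= M.
Proof.
move=> cf [N [mN N0 fN]] x; rewrite leNgt; apply/negP => Mfx.
have [e /= e0 xeM] : nbhs_ball x (f @^-1` [set y | M < y]).
  by apply/nbhs_ballP; apply: cf; exact: lt_nbhsr.
suff : (0 < lebesgue_measure N)%E by rewrite N0 ltxx.
apply: (@lt_le_trans _ _ (lebesgue_measure (`]x - e, x + e[%classic : set R))).
  by rewrite lebesgue_measure_itv /= lte_fin ltrD2l gtrN // -EFinB lte_fin; lra.
rewrite le_measure ?inE //.
move=> y /=; rewrite in_itv /= => /andP[xy yx]; apply: fN => /= fy.
have /xeM /= : ball x e y by rewrite /ball /= ltr_norml; apply/andP; split; lra.
by rewrite ltNge fy.
Qed.

(** The norm of exponent [+oo] unfolds to an essential supremum only when the whole space has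
    positive measure; otherwise it has the default value 0. *)
Lemma lebesgue_measure_setT_gt0 {R : realType} :
  (0 < lebesgue_measure [set: R])%E.
Proof.
apply: (@lt_le_trans _ _ (lebesgue_measure (`]0, 1[%classic : set R))).
  by rewrite lebesgue_measure_itv /= lte_fin ltr01 sube0 lte_fin.
by rewrite le_measure ?inE.
Qed.

Lemma supnorm_leP {R : realType} (f : R -> R) (M : R) :
  (supnorm f <= M%:E)%E <-> \forall x \ae @lebesgue_measure R, `|f x| <= M.
Proof.
rewrite /supnorm unlock lebesgue_measure_setT_gt0.
have aeF := ae_filter_ringOfSetsType (@lebesgue_measure R).
split => [/ess_supP|fM]; last apply/ess_supP.
  by apply: filterS => x /=; rewrite lee_fin.
by apply: filterS fM => x /=; rewrite lee_fin.
Qed.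

Lemma le_supnorm {R : realType} (f : R -> R) (M : R) :
  (forall x, `|f x| <= M) -> (supnorm f <= M%:E)%E.
Proof. by move=> fM; apply/supnorm_leP; apply: aeW. Qed.

Lemma supnorm_continuous_le {R : realType} (f : R -> R) (M : R) :
  continuous f -> (supnorm f <= M%:E)%E -> forall x, `|f x| <= M.
Proof.
move=> cf /supnorm_leP; apply: (@ae_le_everywhere _ (fun x => `|f x|)).
by move=> x; apply: continuous_comp; [exact: cf|exact: norm_continuous].
Qed.

(** It supplies the zero data of the negative case and the values of the estimator for [2 < j]. *)
Lemma Linfty_of_continuous {R : realType} (f : R -> R) (M : R) :
  continuous f -> (forall x, `|f x| <= M) ->
  exists g : Linfty R, (g : R -> R) = f %[ae @lebesgue_measure R].
Proof.
move=> cf fM.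
have mf : measurable_fun setT (f : measurableTypeR R -> measurableTypeR R).
  exact: continuous_measurable_fun.
pose F : {mfun measurableTypeR R >-> measurableTypeR R} :=
  HB.pack (f : measurableTypeR R -> measurableTypeR R)
    (isMeasurableFun.Build _ _ _ _ _ mf).
pose G : aeEqMfun (measurableTypeR R) (@lebesgue_measure R) :=
  (\pi_(aeEqMfun (measurableTypeR R) (@lebesgue_measure R)) F)%qT.
have GE : (G : R -> R) = f %[ae @lebesgue_measure R].
  (* The chosen representative may differ from [f] on a null set; [reprK] equates the classes, and
     this unfolds to equality almost everywhere. *)
  have /eqP/eqmodP/asboolP : (\pi_(aeEqMfun (measurableTypeR R)
    (@lebesgue_measure R)) (repr G) == \pi F)%qT by rewrite reprK.
  exact.
have Goo : finite_norm (@lebesgue_measure R) +oo (G : R -> R).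
  apply: (@le_lt_trans _ _ M%:E); last exact: ltry.
  apply/supnorm_leP; have aeF := ae_filter_ringOfSetsType (@lebesgue_measure R).
  by apply: filterS GE => x /(_ I) ->.
pose g : Linfty R := HB.pack G (isFinLebesgue.Build _ _ _ _ _ (leey 1) _ Goo).
by exists g.
Qed.

(** * Hölder bounds *)

Lemma holder_seminorm_ge0 {R : realType} (a : R) (f : R -> R) :
  (0 <= holder_seminorm a f)%E.
Proof.
have /ereal_sup_ubound : [set (`|f z.1 - f z.2| / `|z.1 - z.2| `^ a)%:E
    | z in [set z : R * R | z.1 != z.2]]
    (`|f 1 - f 0| / `|1 - 0| `^ a)%:E.
  by exists (1, 0) => //=; rewrite oner_eq0.
by apply: le_trans; rewrite lee_fin divr_ge0 ?powR_ge0.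
Qed.

Lemma holder_seminorm_le {R : realType} (a M : R) (f : R -> R) :
  0 <= M -> (holder_seminorm a f <= M%:E)%E ->
  forall x y, `|f x - f y| <= M * `|x - y| `^ a.
Proof.
move=> M0 fM x y; have [->|xy] := eqVneq x y.
  by rewrite subrr normr0 mulr_ge0 ?powR_ge0.
have /ereal_sup_ubound/le_trans/(_ fM) :
    [set (`|f z.1 - f z.2| / `|z.1 - z.2| `^ a)%:E
    | z in [set z : R * R | z.1 != z.2]] (`|f x - f y| / `|x - y| `^ a)%:E.
  by exists (x, y).
by rewrite lee_fin ler_pdivrMr // powR_gt0 // normr_gt0 subr_eq0.
Qed.

(** * Mean value estimates and a Landau-Kolmogorov inequality *)

Lemma mean_value {R : realType} (f df : R -> R) (a b : R) :
  (forall x : R, is_derive x 1 f (df x)) -> a <= b ->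
  exists2 c, a <= c <= b & f b - f a = df c * (b - a).
Proof.
move=> fdf ab; have [|c] := MVT_segment ab (fun x _ => fdf x).
  apply: derivable_within_continuous => x _.
  exact: (@ex_derive _ _ _ _ _ _ _ (fdf x)).
by rewrite in_itv /=; exists c.
Qed.

Lemma lipschitz_of_derive {R : realType} (f df : R -> R) (M : R) :
  (forall x : R, is_derive x 1 f (df x)) -> (forall x, `|df x| <= M) ->
  forall x y, `|f x - f y| <= M * `|x - y|.
Proof.
move=> fdf dfM x y; wlog yx : x y / y <= x.
  by move=> H; have [/H//|/ltW/H] := leP y x; rewrite distrC (distrC y).
have [c _ ->] := mean_value _ _ _ _ fdf yx.
by rewrite normrM ler_wpM2r.
Qed.

(** Windows of length [2 ^+ n - 1] starting at [x] and at [x + 2 ^+ n] are at distance 1, so the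
    mean value theorem between a point of each costs only a factor 2. *)
Lemma exists_small_derivative {R : realType} (n : nat) (U : nat -> R -> R)
    (A : R) :
  (forall i (x : R), (i < n)%N -> is_derive x 1 (U i) (U i.+1 x)) ->
  (forall x, `|U 0 x| <= A) ->
  forall x, exists2 c, x <= c <= x + (2 ^+ n - 1) & `|U n c| <= 2 ^+ n * A.
Proof.
elim: n => [|n IH] dU UA x.
  by exists x; rewrite ?expr0 ?mul1r// subrr addr0 lexx.
have {}IH := IH (fun i x (ni : (i < n)%N) => dU i x (ltnW ni)) UA.
have [c1 /andP[xc1 c1x] Uc1] := IH x.
have [c2 /andP[xc2 c2x] Uc2] := IH (x + 2 ^+ n).
have c12 : 1 <= c2 - c1 by lra.
have c1c2 : c1 <= c2 by lra.
have [c /andP[c1c cc2] Uc] :=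
  mean_value _ _ _ _ (fun x => dU n x (ltnSn n)) c1c2.
exists c; first by rewrite exprS; apply/andP; split; lra.
have : `|U n.+1 c| * 1 <= `|U n.+1 c| * `|c2 - c1|.
  by rewrite ler_wpM2l // ger0_norm //; lra.
rewrite mulr1 -normrM -Uc => /le_trans; apply.
by rewrite (le_trans (ler_normB _ _)) // exprS; lra.
Qed.

(** The constants depend on the order alone, and [h] stays free so that the two terms can be
    balanced later. [U] lists a function and its successive derivatives, which lets the bound apply
    to a difference of two functions. *)
Lemma landau_first_derivative {R : realType} (k : nat) :
  exists a b : R, forall (U : nat -> R -> R) (A B : R),
    (forall i (x : R), (i < k.+2)%N -> is_derive x 1 (U i) (U i.+1 x)) ->
    (forall x, `|U 0 x| <= A) -> (forall x, `|U k.+2 x| <= B) ->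
    forall h x, 0 < h -> `|U 1 x| <= 2 * A / h + h * (a * A + b * B).
Proof.
elim: k => [|k [a [b IH]]].
  exists 0, 1 => U A B dU UA UB h x h0.
  have xh : x <= x + h by lra.
  have [c /andP[xc cx] Uc] := mean_value _ _ _ _ (fun x => dU 0 x isT) xh.
  rewrite mul0r add0r mul1r.
  (* [U 1 c] is the slope of [U 0] over an interval of length [h], hence at most [2 * A / h] in
     absolute value; between [c] and [x], [U 1] varies by at most [B * h]. *)
  have -> : U 1 x = U 1 c + (U 1 x - U 1 c) by ring.
  rewrite (le_trans (ler_normD _ _)) // lerD //.
    rewrite ler_pdivlMr // -{1}(gtr0_norm h0) -normrM.
    have -> : U 1 c * h = U 0 (x + h) - U 0 x by rewrite Uc; ring.
    by rewrite (le_trans (ler_normB _ _)) // mulrDl mul1r lerD.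
  rewrite (le_trans (lipschitz_of_derive _ _ _
    (fun x => dU 1 x isT) UB _ _)) //.
  rewrite mulrC ler_wpM2r ?(le_trans (normr_ge0 _) (UB x)) //.
  by rewrite ler_norml; apply/andP; split; lra.
pose N : R := 2 ^+ k.+2.
(* [exists_small_derivative] gives a point within [N - 1] of [y] where the
   derivative of order [k.+2] is at most [N * A]; it is Lipschitz of constant
   [B], so the induction hypothesis applies with a larger bound. *)
exists (a + b * N), (b * (N - 1)) => U A B dU UA UB h x h0.
have {}UB y : `|U k.+2 y| <= N * A + (N - 1) * B.
  have [c /andP[yc cy] Uc] := exists_small_derivative _ _ _
    (fun i x (ik : (i < k.+2)%N) => dU i x (ltnW ik)) UA y.
  have -> : U k.+2 y = U k.+2 c + (U k.+2 y - U k.+2 c) by ring.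
  rewrite (le_trans (ler_normD _ _)) // lerD //.
  rewrite (le_trans (lipschitz_of_derive _ _ _
    (fun x => dU k.+2 x (ltnSn _)) UB _ _)) //.
  rewrite mulrC ler_wpM2r ?(le_trans (normr_ge0 _) (UB x)) //.
  by rewrite ler_norml; apply/andP; split; rewrite /N; lra.
have -> : (a + b * N) * A + b * (N - 1) * B = a * A + b * (N * A + (N - 1) * B).
  by ring.
exact: IH (fun i x (ik : (i < k.+2)%N) => dU i x (ltnW ik)) UA UB h x h0.
Qed.

(** * Truncation error of the central difference quotient *)

(** The quotient is a mean slope, hence a value of [df] within [h] of [x]; the error is then an
    oscillation of [df]. *)
Lemma diffquot_error_first {R : realType} (f df : R -> R) (h E x : R) :
  (forall x : R, is_derive x 1 f (df x)) -> 0 < h ->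
  (forall y, `|y - x| <= h -> `|df y - df x| <= E) ->
  `|diffquot h f x - df x| <= E.
Proof.
move=> fdf h0 dfE; have xh : x - h <= x + h by lra.
have [c /andP[xc cx] fE] := mean_value _ _ _ _ fdf xh.
have -> : diffquot h f x = df c.
  by rewrite /diffquot fE; field; rewrite gt_eqF.
by apply: dfE; rewrite ler_norml; apply/andP; split; lra.
Qed.

(** Symmetry cancels the second-order Taylor term. Two rounds of the mean value theorem and the
    Lipschitz bound on [f2] give the constant [M], larger than the sharp [M / 6]. *)
Lemma diffquot_error_third {R : realType} (f f1 f2 f3 : R -> R) (h M x : R) :
  (forall x : R, is_derive x 1 f (f1 x)) ->
  (forall x : R, is_derive x 1 f1 (f2 x)) ->
  (forall x : R, is_derive x 1 f2 (f3 x)) -> 0 < h ->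
  (forall y, `|f3 y| <= M) ->
  `|diffquot h f x - f1 x| <= M * h ^+ 2.
Proof.
move=> df df1 df2 h0 f3M.
(* The symmetric increment minus its linear part: it vanishes at 0, so [p h] is [h] times a value of
   its derivative. *)
pose p (t : R) := f (x + t) - f (x - t) - 2 * f1 x * t.
have dp (t : R) : is_derive t 1 p (f1 (x + t) + f1 (x - t) - 2 * f1 x).
  have dr : is_derive t 1 (fun t : R => x + t) 1.
    by apply: (is_derive_eq (f := cst x + @id R)); rewrite add0r.
  have dl : is_derive t 1 (fun t : R => x - t) (- 1).
    by apply: (is_derive_eq (f := cst x - @id R)); rewrite add0r.
  have d1 : is_derive t 1 (fun t : R => f (x + t)) (f1 (x + t) * 1).
    exact: is_derive1_comp (df _) dr.
  have d2 : is_derive t 1 (fun t : R => f (x - t)) (f1 (x - t) * -1).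
    exact: is_derive1_comp (df _) dl.
  apply: is_derive_eq (is_deriveB (is_deriveB d1 d2)
    (is_deriveZ (2 * f1 x) (is_derive_id t 1))) _.
  by rewrite /GRing.scale /=; ring.
have [t /andP[t0 th]] := mean_value _ _ _ _ dp (ltW h0).
have xt : x <= x + t by lra.
have tx : x - t <= x by lra.
have [c1 /andP[xc1 c1x] e1] := mean_value _ _ _ _ df1 xt.
have [c2 /andP[xc2 c2x] e2] := mean_value _ _ _ _ df1 tx.
have -> : f1 (x + t) + f1 (x - t) - 2 * f1 x = (f2 c1 - f2 c2) * t by lra.
move=> ph; have -> : diffquot h f x - f1 x = (f2 c1 - f2 c2) * t / 2.
  have {ph} : f (x + h) - f (x - h) = 2 * f1 x * h + (f2 c1 - f2 c2) * t * h.
    by move: ph; rewrite /p !addr0 !subr0; lra.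
  by rewrite /diffquot => ->; field; rewrite gt_eqF.
rewrite !normrM (ger0_norm t0) (gtr0_norm (_ : 0 < 2^-1 :> R)) ?invr_gt0 //.
have M0 : 0 <= M by rewrite (le_trans _ (f3M x)).
have cM : `|f2 c1 - f2 c2| <= M * (2 * t).
  rewrite (le_trans (lipschitz_of_derive _ _ _ df2 f3M _ _)) // ler_wpM2l //.
  by rewrite ler_norml; apply/andP; split; lra.
have : `|f2 c1 - f2 c2| * t <= M * (2 * t) * t by rewrite ler_wpM2r.
have : M * (t * t) <= M * (h * h) by rewrite ler_wpM2l // ler_pM.
rewrite expr2; lra.
Qed.

(** * Regularity and a priori bounds of the members of [Kclass] *)

Lemma continuously_derivable_is_derive {R : realType} (k i : nat) (f : R -> R)
    (x : R) :
  continuously_derivable k f -> (i < k)%N ->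
  is_derive x 1 f^`(i) (f^`(i.+1) x).
Proof.
by move=> [df _] ik; apply: DeriveDef; [exact: df|rewrite derive1nS derive1E].
Qed.

Lemma continuously_derivable_continuous {R : realType} (k i : nat)
    (f : R -> R) :
  continuously_derivable k f -> (i <= k)%N -> continuous f^`(i).
Proof.
move=> [df cf]; rewrite leq_eqVlt => /predU1P[->//|ik] x.
by apply: differentiable_continuous; apply/derivable1_diffP; exact: df.
Qed.

Lemma Kclass_is_derive {R : realType} (j m delta : R) (g : Linfty R)
    (f : R -> R) (x : R) :
  Kclass j m delta g f -> is_derive x 1 f (f^`() x).
Proof.
move=> [cf _ _]; rewrite -derive1n1 -{1}(derive1n0 f).
by apply: continuously_derivable_is_derive cf _; rewrite leq_max.
Qed.

Lemma Kclass_continuous {R : realType} (j m delta : R) (g : Linfty R)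
    (f : R -> R) :
  Kclass j m delta g f -> continuous f /\ continuous f^`().
Proof.
move=> [cf _ _]; split.
  exact: (@continuously_derivable_continuous _ _ 0 _ cf).
rewrite -derive1n1; apply: continuously_derivable_continuous cf _.
by rewrite leq_max.
Qed.

Lemma Kclass_holder {R : realType} (j m delta : R) (g : Linfty R)
    (f : R -> R) :
  1 < j <= 2 -> 0 <= m -> Kclass j m delta g f ->
  forall x y, `|derive1 f x - derive1 f y| <= m * `|x - y| `^ (j - 1).
Proof.
move=> /andP[j1 j2] m0 [_ _]; rewrite /apriori_norm j2.
rewrite (gt_eqF j1) (gt_eqF (lt_trans ltr01 j1)) => fm.
apply: holder_seminorm_le => //; apply: le_trans fm.
by rewrite leeDr // Lnorm_ge0.
Qed.

(** The Hölder seminorm is nonnegative, so the sup norm summand alone is at most [m]; continuity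
    makes this essential bound pointwise. *)
Lemma Kclass_bounded_derivative {R : realType} (j m delta : R) (g : Linfty R)
    (f : R -> R) :
  2 < j -> Kclass j m delta g f ->
  continuously_derivable (Num.truncn j) f /\
  forall x, `|derive1n (Num.truncn j) f x| <= m.
Proof.
move=> j2 [+ _]; rewrite /class_order /apriori_norm (lt_geF j2).
have j1 : 1 < j by lra.
rewrite (gt_eqF j1) (gt_eqF (lt_trans ltr01 j1)).
have /maxn_idPr -> : (1 <= Num.truncn j)%N by rewrite truncn_gt0 ltW.
move=> cf fm; split => //.
apply: supnorm_continuous_le; first by case: cf.
apply: le_trans fm; case: ifP => // _.
by rewrite leeDl // holder_seminorm_ge0.
Qed.

(** * Worst-case error of [L_op] *)

(** The quotient of the noise [f - g] is at most [2 * delta / (2 * h)], almost everywhere because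
    translates of null sets are null. *)
Lemma diffquot_op_error {R : realType} (g : Linfty R) (f : R -> R)
    (h delta E : R) :
  0 < h -> (supnorm (f \- g)%R <= delta%:E)%E ->
  (forall x, `|diffquot h f x - derive1 f x| <= E) ->
  (supnorm (diffquot_op h g \- derive1 f)%R <= (delta / h + E)%:E)%E.
Proof.
move=> h0 /supnorm_leP fg fE; apply/supnorm_leP.
have aeF := ae_filter_ringOfSetsType (@lebesgue_measure R).
apply: (@filterS3 _ _ aeF _ _ _ _ _ (diffquot_classE h g)
  (ae_shift h fg) (ae_shift (- h) fg)) => x /(_ I) gE fgp fgm /=.
rewrite gE; have -> : diffquot h g x - derive1 f x =
    (diffquot h f x - derive1 f x) -
    ((f (x + h) - g (x + h)) - (f (x - h) - g (x - h))) / (2 * h).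
  by rewrite /diffquot; field; rewrite gt_eqF.
rewrite (le_trans (ler_normB _ _)) // (addrC (delta / h)) lerD //.
rewrite normrM normfV (gtr0_norm (_ : 0 < 2 * h)) ?mulr_gt0 //.
rewrite ler_pdivrMr ?mulr_gt0 // (le_trans (ler_normB _ _)) //.
rewrite (_ : delta / h * (2 * h) = delta + delta) ?lerD //.
by field; rewrite gt_eqF.
Qed.

Lemma diffquot_step_powR {R : realType} (j m delta s : R) :
  diffquot_step j m delta `^ s = (delta / (m * (j - 1))) `^ (s / j).
Proof. by rewrite /diffquot_step -powRrM (mulrC s). Qed.

Lemma diffquot_step_gt0 {R : realType} (j m delta : R) :
  0 < m -> 1 < j -> 0 < delta -> 0 < diffquot_step j m delta.
Proof.
by move=> m0 j1 d0; rewrite powR_gt0 // divr_gt0 // mulr_gt0 // subr_gt0.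
Qed.

Lemma diffquot_step_cvg0 {R : realType} (j m s : R) :
  0 < m -> 1 < j -> 0 < s ->
  diffquot_step j m delta `^ s @[delta --> 0^'+] --> 0.
Proof.
move=> m0 j1 s0; pose c := (m * (j - 1))^-1.
have c0 : 0 < c by rewrite invr_gt0 mulr_gt0 // subr_gt0.
have sj0 : 0 < s / j by rewrite divr_gt0 // (lt_trans ltr01).
have : delta `^ (s / j) * c `^ (s / j) @[delta --> 0^'+] --> 0 * c `^ (s / j).
  by apply: cvgM; [exact: powR_cvg0|exact: cvg_cst].
(* The power of a product splits for nonnegative bases; the filter provides [0 < d]. *)
rewrite mul0r; apply: cvg_trans; apply: near_eq_cvg; near=> d.
by rewrite diffquot_step_powR powRM // ltW.
Unshelve. all: by end_near. Qed.

(* First-order condition for the minimiser of [delta / h + m * h `^ (j - 1)]. *)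
Lemma noise_over_step {R : realType} (j m delta : R) :
  0 < m -> 1 < j -> 0 < delta ->
  delta / diffquot_step j m delta =
  m * (j - 1) * diffquot_step j m delta `^ (j - 1).
Proof.
move=> m0 j1 d0; have h0 := diffquot_step_gt0 _ _ _ m0 j1 d0.
have j0 : 0 < j := lt_trans ltr01 j1.
have j10 : 0 < j - 1 by rewrite subr_gt0.
apply: (mulIf (lt0r_neq0 h0)); rewrite divfK ?lt0r_neq0 //.
rewrite mulrAC -mulrA mulr_powRB1 ?(ltW h0) //.
rewrite diffquot_step_powR divff ?lt0r_neq0 // powRr1.
  by rewrite mulrC divfK // lt0r_neq0 // mulr_gt0.
by rewrite divr_ge0 ?mulr_ge0 // ltW.
Qed.

(** The truncation exponent [p] is left open: one bound serves both the rate, where [p = j - 1], and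
    stability for all [j < 4]. *)
Lemma worst_case_error_L_op {R : realType} (j m delta p : R) :
  0 < m -> 1 < j -> 0 < delta ->
  (forall g f h x, Kclass j m delta g f -> 0 < h ->
     `|diffquot h f x - derive1 f x| <= m * h `^ p) ->
  (worst_case_error j m delta (L_op j m delta) <=
   (m * (j - 1) * diffquot_step j m delta `^ (j - 1) +
    m * diffquot_step j m delta `^ p)%:E)%E.
Proof.
move=> m0 j1 d0 fE; have h0 := diffquot_step_gt0 _ _ _ m0 j1 d0.
apply: ge_ereal_sup => _ [[f g] /= fK <-].
rewrite -noise_over_step //; apply: diffquot_op_error => //.
  by case: fK.
by move=> x; apply: fE fK _.
Qed.

Lemma Kclass_diffquot_holder {R : realType} (j m delta : R) (g : Linfty R)
    (f : R -> R) (h x : R) :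
  1 < j <= 2 -> 0 <= m -> Kclass j m delta g f -> 0 < h ->
  `|diffquot h f x - derive1 f x| <= m * h `^ (j - 1).
Proof.
move=> j12 m0 fK h0; apply: diffquot_error_first => // [y|y yh].
  exact: Kclass_is_derive fK.
rewrite (le_trans (Kclass_holder _ _ _ _ _ j12 m0 fK _ _)) // ler_wpM2l //.
by apply: ge0_ler_powR; rewrite ?nnegrE ?normr_ge0 //; lra.
Qed.

Lemma Kclass_diffquot_error {R : realType} (j m : R) :
  1 < j < 4 -> 0 <= m ->
  exists2 p : R, 0 < p & forall delta g f h x, Kclass j m delta g f -> 0 < h ->
    `|diffquot h f x - derive1 f x| <= m * h `^ p.
Proof.
move=> /andP[j1 j4] m0; have [j2|j2] := leP j 2.
  exists (j - 1); first by rewrite subr_gt0.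
  by move=> delta g f h x; apply: Kclass_diffquot_holder => //; rewrite j1.
have [j3|j3] := ltP j 3.
  have k2 : Num.truncn j = 2%N by apply: truncn_def; rewrite ltW.
  exists 1 => // delta g f h x fK h0; rewrite powRr1 ?(ltW h0) //.
  have [df fm] := Kclass_bounded_derivative _ _ _ _ _ j2 fK.
  rewrite k2 in df fm.
  apply: diffquot_error_first => // [y|y yh]; first exact: Kclass_is_derive fK.
  have df1 (z : R) : is_derive z 1 f^`() (f^`(2%N) z).
    exact: (continuously_derivable_is_derive 2 1 f z df isT).
  rewrite (le_trans (lipschitz_of_derive _ _ _ df1 fm _ _)) //.
  by rewrite ler_wpM2l.
have k3 : Num.truncn j = 3%N by apply: truncn_def; rewrite j3.
exists 2 => // delta g f h x fK h0.
have [df fm] := Kclass_bounded_derivative _ _ _ _ _ j2 fK.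
rewrite k3 in df fm.
rewrite powR_mulrn ?(ltW h0) //; apply: diffquot_error_third fm => // z.
- exact: (continuously_derivable_is_derive 3 0 f z df isT).
- exact: (continuously_derivable_is_derive 3 1 f z df isT).
- exact: (continuously_derivable_is_derive 3 2 f z df isT).
Qed.

Lemma L_op_stable {R : realType} (j m : R) :
  0 < m -> 1 < j < 4 -> stable_estimator j m (L_op j m).
Proof.
move=> m0 j14; have [p p0 fE] := Kclass_diffquot_error _ _ j14 (ltW m0).
have /andP[j1 _] := j14.
exists (fun delta => m * (j - 1) * diffquot_step j m delta `^ (j - 1) +
                     m * diffquot_step j m delta `^ p); split.
  by move=> delta d0; apply: worst_case_error_L_op => // g f h x; apply: fE.
have step0 c s : 0 < s ->
    c * diffquot_step j m delta `^ s @[delta --> 0^'+] --> c * 0.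
  by move=> s0; apply: cvgM; [exact: cvg_cst|exact: diffquot_step_cvg0].
have j10 : 0 < j - 1 by rewrite subr_gt0.
have := cvgD (step0 (m * (j - 1)) _ j10) (step0 m _ p0).
rewrite !mulr0 addr0; exact.
Qed.

(** With [p = j - 1] both terms are multiples of the same power of the step and add up to [j * m]
    times it. Inserting the step gives the stated bound exactly, so an equality is proved. *)
Lemma L_op_rate {R : realType} (j m delta : R) :
  0 < m -> 1 < j <= 2 -> 0 < delta ->
  (worst_case_error j m delta (L_op j m delta)
    <= (rate_constant j m * delta `^ ((j - 1) / j))%:E)%E.
Proof.
move=> m0 j12 d0; have /andP[j1 _] := j12.
have j0 : 0 < j := lt_trans ltr01 j1.
have j10 : 0 < j - 1 by rewrite subr_gt0.
apply: le_trans (worst_case_error_L_op _ _ _ (j - 1) m0 j1 d0 _) _.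
  by move=> g f h x; apply: Kclass_diffquot_holder => //; exact: ltW.
rewrite lee_fin le_eqVlt diffquot_step_powR /rate_constant.
set X := delta / _; set q := (j - 1) / j.
have X0 : 0 < X by rewrite divr_gt0 ?mulr_gt0.
have mj0 : 0 < m * (j - 1) by rewrite mulr_gt0.
have -> : delta `^ q = X `^ q * (m `^ q * (j - 1) `^ q).
  rewrite -!powRM ?(ltW mj0) ?(ltW m0) ?(ltW j10) ?(ltW X0) //.
  by rewrite divfK // lt0r_neq0.
(* The first factor is the one in [rate_constant]; the second cancels the power of [m] in the
   denominator of [X]. *)
have mE : m = m `^ j^-1 * m `^ q.
  have jq : j^-1 + q = 1 by rewrite /q; field; rewrite lt0r_neq0.
  by rewrite -powRD jq ?powRr1 ?(ltW m0) // oner_eq0.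
have B0 : (j - 1) `^ q != 0 by rewrite lt0r_neq0 // powR_gt0.
apply/orP; left; apply/eqP; transitivity (j * X `^ q * (m `^ j^-1 * m `^ q)).
  by rewrite -mE; ring.
by field.
Qed.

(** * Nonexistence for [j = 0] and [j = 1] *)

Lemma is_derive_scaled_sin {R : realType} (d c x : R) :
  is_derive x 1 (fun y : R => d * sin (c * y)) (d * c * cos (c * x)).
Proof.
have dc : is_derive x 1 (fun y : R => c * y) c.
  apply: is_derive_eq (is_deriveZ c (is_derive_id x 1)) _.
  by rewrite /GRing.scale /= mulr1.
apply: is_derive_eq
  (is_deriveZ d (is_derive1_comp (is_derive_sin (c * x)) dc)) _.
by rewrite /GRing.scale /=; ring.
Qed.

Lemma derive1_scaled_sin {R : realType} (d c : R) :
  (fun x : R => d * sin (c * x))^`() = (fun x => (d * c * cos (c * x))%R).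
Proof.
apply/funext => x; rewrite derive1E.
by have [_ ->] := is_derive_scaled_sin d c x.
Qed.

Lemma scaled_cos_continuous {R : realType} (d c : R) :
  continuous (fun x : R => d * cos (c * x)).
Proof.
move=> x; apply: cvgM; first exact: cvg_cst.
apply: continuous_comp; last exact: continuous_cos.
by apply: cvgM; [exact: cvg_cst|exact: cvg_id].
Qed.

(** [d <= m] controls the function, for [j = 0], and the bound on [d * |c|] controls its derivative,
    for [j = 1]. Both signs of [c] are allowed, which covers the opposite function. *)
Lemma Kclass_scaled_sin {R : realType} (j m d c : R) (g : Linfty R) :
  j = 0 \/ j = 1 -> 0 <= d -> d <= m -> d * `|c| <= m ->
  (g : R -> R) = cst 0 %[ae @lebesgue_measure R] ->
  Kclass j m d g (fun x => d * sin (c * x)).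
Proof.
move=> j01 d0 dm dcm g0.
have sind x : `|d * sin (c * x)| <= d.
  by rewrite normrM (ger0_norm d0) ler_piMr // sin_max.
have cosm x : `|d * c * cos (c * x)| <= m.
  rewrite (le_trans _ dcm) // !normrM (ger0_norm d0).
  by rewrite ler_piMr ?mulr_ge0 // cos_max.
have ord1 : class_order j = 1%N.
  by rewrite /class_order; case: j01 => ->; rewrite ?truncn0 ?truncn1.
split.
- rewrite ord1; split; last first.
    by rewrite derive1n1 derive1_scaled_sin; exact: scaled_cos_continuous.
  by case => // x _; rewrite derive1n0; case: (is_derive_scaled_sin d c x).
- apply/supnorm_leP; have aeF := ae_filter_ringOfSetsType (@lebesgue_measure R).
  by apply: filterS g0 => x /(_ I) /= ->; rewrite subr0.
- rewrite /apriori_norm; case: j01 => ->; rewrite ?eqxx ?oner_eq0.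
    by apply: le_supnorm => x; rewrite (le_trans (sind x)).
  by rewrite derive1_scaled_sin; exact: le_supnorm.
Qed.

(** For zero data, [T g] is within [e] of a cosine of amplitude [m] and of its opposite, so the
    cosine is at most [e]. As [T g] is known only almost everywhere, continuity is used before
    evaluating at 0. *)
Lemma worst_case_error_ge {R : realType} (j m delta e : R)
    (T : Linfty R -> Linfty R) :
  j = 0 \/ j = 1 -> 0 < delta <= m ->
  (worst_case_error j m delta T <= e%:E)%E -> m <= e.
Proof.
move=> j01 /andP[d0 dm] Te.
have [|g g0] := @Linfty_of_continuous R (cst 0) 0 (@cst_continuous _ _ 0).
  by move=> x; rewrite normr0.
have cE c : delta * `|c| <= m ->
    \forall x \ae @lebesgue_measure R,
      `|(T g : R -> R) x - delta * c * cos (c * x)| <= e.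
  move=> cm; have fK := Kclass_scaled_sin _ _ _ _ _ j01 (ltW d0) dm cm g0.
  suff /supnorm_leP : (supnorm
      (T g \- derive1 (fun x : R => delta * sin (c * x)))%R <= e%:E)%E.
    by rewrite derive1_scaled_sin.
  apply: le_trans Te; apply: ereal_sup_ubound.
  by exists ((fun x : R => delta * sin (c * x)), g).
(* The largest frequency with [delta * c <= m]. *)
pose c := m / delta.
have dc : delta * c = m by rewrite /c mulrC divfK // lt0r_neq0.
have c0 : 0 < c by rewrite divr_gt0 // (lt_le_trans d0).
have pE := cE c; have nE := cE (- c).
rewrite normrN (gtr0_norm c0) dc lexx in pE nE.
have : forall x : R, m * cos (c * x) <= e.
  apply: ae_le_everywhere; first exact: scaled_cos_continuous.
  have aeF := ae_filter_ringOfSetsType (@lebesgue_measure R).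
  apply: (@filterS2 _ _ aeF _ _ _ _ (pE isT) (nE isT)) => x.
  rewrite mulrN !mulNr cosN dc !ler_norml; lra.
by move/(_ 0); rewrite mulr0 cos0 mulr1.
Qed.

Lemma no_stable_estimator {R : realType} (j m : R) :
  0 < m -> j = 0 \/ j = 1 ->
  ~ exists T : R -> Linfty R -> Linfty R, stable_estimator j m T.
Proof.
move=> m0 j01 [T [eta [Teta eta0]]].
have [d [d0 dm etam]] : exists d, [/\ 0 < d, d <= m & eta d < m].
  near (0 : R)^'+ => d; exists d; split=> //.
    by near: d; apply: nbhs_right_le.
  by near: d; apply: (cvgr_lt _ eta0).
have := worst_case_error_ge _ _ _ _ _ j01 _ (Teta d d0).
by rewrite d0 dm leNgt etam => /(_ isT).
Unshelve. all: by end_near. Qed.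

(** * Existence for [2 < j] by selecting a compatible function *)

Lemma truncn_ge2 {R : realType} (j : R) :
  2 < j -> exists k, Num.truncn j = k.+2.
Proof.
move=> j2; have : (1 < Num.truncn j)%N by rewrite truncn_gt_nat ltW.
by case: (Num.truncn j) => [|[|k]] // _; exists k.
Qed.

(** This puts the derivative of a selected member in [Linfty R]: the data are essentially bounded,
    hence so is [f], and the Landau inequality passes to the derivative. The bound may depend on
    [g]. *)
Lemma Kclass_derive1_bounded {R : realType} (j m delta : R) (g : Linfty R)
    (f : R -> R) :
  2 < j -> Kclass j m delta g f -> exists M, forall x, `|derive1 f x| <= M.
Proof.
move=> j2 fK; have [df fm] := Kclass_bounded_derivative _ _ _ _ _ j2 fK.
have [k kE] := truncn_ge2 _ j2.
rewrite kE in df fm.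
have [M gM] : exists M : R, (supnorm (g : R -> R) <= M%:E)%E.
  have := Lebesgue_finite (s := g); rewrite /finite_norm /supnorm.
  case: ('N[_]_+oo[_])%E => [r _|//|_]; first by exists r.
  by exists 0; exact: leNye.
have [a [b landau]] := @landau_first_derivative R k.
(* The bound is read off from the Landau inequality at [h = 1]. *)
eexists => x; rewrite -derive1n1.
apply: (landau (fun i => f^`(i)) (delta + M) m _ _ fm 1 x ltr01) => [i y ik|].
  exact: continuously_derivable_is_derive df ik.
have [cf _] := Kclass_continuous _ _ _ _ _ fK.
apply: supnorm_continuous_le => //; apply/supnorm_leP.
have [_ /supnorm_leP fg _] := fK; move/supnorm_leP in gM.
have aeF := ae_filter_ringOfSetsType (@lebesgue_measure R).
apply: (@filterS2 _ _ aeF _ _ _ _ fg gM) => y /= fgy gy.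
by rewrite -(subrK (g y) (f y)) (le_trans (ler_normD _ _)) // lerD.
Qed.

(** The Landau inequality is applied to [f1 - f2] with [A = 2 * delta] and [B = 2 * m]. Taking [h]
    to be the square root of [delta] makes both terms vanish as [delta] tends to 0. *)
Lemma Kclass_derive1_close {R : realType} (j m : R) :
  2 < j ->
  exists a b : R, forall delta g f1 f2, 0 < delta ->
    Kclass j m delta g f1 -> Kclass j m delta g f2 ->
    forall x, `|derive1 f1 x - derive1 f2 x| <=
      delta `^ 2^-1 * (4 + a * delta + b).
Proof.
move=> j2; have [k kE] := truncn_ge2 _ j2.
have [a [b landau]] := @landau_first_derivative R k.
exists (2 * a), (2 * b * m) => delta g f1 f2 d0 f1K f2K x.
have [df1 f1m] := Kclass_bounded_derivative _ _ _ _ _ j2 f1K.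
have [df2 f2m] := Kclass_bounded_derivative _ _ _ _ _ j2 f2K.
rewrite kE in df1 f1m df2 f2m.
set h := delta `^ 2^-1; have h0 : 0 < h by rewrite powR_gt0.
have hh : delta = h * h.
  have half : 2^-1 + 2^-1 = 1 :> R by lra.
  by rewrite /h -powRD half ?powRr1 ?(ltW d0) // oner_eq0.
pose U i y := derive1n i f1 y - derive1n i f2 y.
have := landau U (2 * delta) (2 * m) _ _ _ h x h0.
have -> : 2 * (2 * delta) / h + h * (a * (2 * delta) + b * (2 * m)) =
    h * (4 + 2 * a * delta + 2 * b * m).
  by rewrite {1}hh; field; rewrite lt0r_neq0.
apply.
- move=> i y ik; apply: is_deriveB.
    exact: continuously_derivable_is_derive df1 ik.
  exact: continuously_derivable_is_derive df2 ik.
- have [cf1 _] := Kclass_continuous _ _ _ _ _ f1K.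
  have [cf2 _] := Kclass_continuous _ _ _ _ _ f2K.
  apply: supnorm_continuous_le.
    by move=> y; apply: cvgB; [exact: cf1|exact: cf2].
  apply/supnorm_leP.
  have [_ /supnorm_leP f1g _] := f1K; have [_ /supnorm_leP f2g _] := f2K.
  have aeF := ae_filter_ringOfSetsType (@lebesgue_measure R).
  apply: (@filterS2 _ _ aeF _ _ _ _ f1g f2g) => y /= f1gy f2gy.
  rewrite /U !derive1n0.
  have -> : f1 y - f2 y = (f1 y - g y) - (f2 y - g y) by ring.
  by rewrite (le_trans (ler_normB _ _)) // mulrDl !mul1r lerD.
- move=> y; rewrite (le_trans (ler_normB _ _)) // mulrDl !mul1r.
  by rewrite lerD.
Qed.

Lemma exists_stable_estimator {R : realType} (j m : R) :
  2 < j -> exists T : R -> Linfty R -> Linfty R, stable_estimator j m T.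
Proof.
move=> j2; have [a [b close]] := Kclass_derive1_close j m j2.
pose eta (delta : R) : R := delta `^ 2^-1 * (4 + a * delta + b).
(* Choice is made over pairs of a noise level and data, so one selection defines the whole family of
   operators. *)
have /choice[T TP] (z : R * Linfty R) : exists t : Linfty R, 0 < z.1 ->
    forall f, Kclass j m z.1 z.2 f ->
    (supnorm (t \- derive1 f)%R <= (eta z.1)%:E)%E.
  case: z => delta g /=.
  (* Data without a compatible member do not enter the supremum; [g] itself is then a default
     value. *)
  have [[f0 f0K]|nK] := pselect (exists f0, Kclass j m delta g f0); last first.
    by exists g => _ f fK; case: nK; exists f.
  have [_ cf0] := Kclass_continuous _ _ _ _ _ f0K.
  have [M f0M] := Kclass_derive1_bounded _ _ _ _ _ j2 f0K.
  have [t tE] := Linfty_of_continuous _ _ cf0 f0M.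
  exists t => d0 f fK; apply/supnorm_leP.
  have aeF := ae_filter_ringOfSetsType (@lebesgue_measure R).
  by apply: filterS tE => x /(_ I) /= ->; exact: close f0K fK _.
exists (fun delta g => T (delta, g)), eta; split.
  move=> delta d0; apply: ge_ereal_sup => _ [[f g] /= fK <-].
  exact: (TP (delta, g) d0 f fK).
have d0 : delta @[delta --> (0 : R)^'+] --> (0 : R).
  exact: cvg_at_right_filter cvg_id.
have : eta delta @[delta --> (0 : R)^'+] --> 0 * (4 + a * 0 + b).
  apply: cvgM; first by apply: powR_cvg0; rewrite invr_gt0.
  apply: cvgD; last exact: cvg_cst.
  apply: cvgD; first exact: cvg_cst.
  by apply: cvgM => //; exact: cvg_cst.
by rewrite mul0r.
Qed.

(* If 4 <= j, the worst-case error of L_op is +oo, because the third derivatives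
   of the members of the class are not uniformly bounded. *)
Theorem theorem2p1 (R : realType) (j m : R) (hm : 0 < m) :
  (j = 0 \/ j = 1 ->
     ~ exists T : R -> Linfty R -> Linfty R, stable_estimator j m T) /\
  (1 < j ->
     (exists T : R -> Linfty R -> Linfty R, stable_estimator j m T) /\
     (j < 4 -> stable_estimator j m (L_op j m)) /\
     (j <= 2 -> forall delta : R, 0 < delta ->
        (worst_case_error j m delta (L_op j m delta)
           <= (rate_constant j m * delta `^ ((j - 1) / j))%:E)%E)).
Proof.
split=> [j01|j1]; first exact: no_stable_estimator.
split; last split.
- have [j2|] := leP j 2; last exact: exists_stable_estimator.
  by exists (L_op j m); apply: L_op_stable => //; rewrite j1; lra.
- by move=> j4; apply: L_op_stable => //; rewrite j1.
- by move=> j2 delta d0; apply: L_op_rate => //; rewrite j1.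
Qed.
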